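(* Suppose that $0<\gamma<1$ is given. Then for every sufficiently large integer $N$ there exist integers $1\le n_1<\cdots<n_N$ and positive numbers $c_1,\dots,c_N$ such that \[ \sum_{k,\ell=1}^N c_k c_\ell \frac{\gcd(n_k,n_\ell)}{\sqrt{n_k n_\ell}} \ge \Big(\sum_{j=1}^N c_j^2\Big)\cdot \exp\left(\gamma\sqrt{\frac{\log N\,\log\log\log N}{\log\log N}}\right). \] *)

(* Defs.v *)
From mathcomp Require Import all_boot all_order all_algebra.
From mathcomp Require Import all_classical all_reals all_analysis.

(* Main.v *)
Require Import Defs.
From mathcomp Require Import all_boot all_order all_algebra.
From mathcomp Require Import all_classical all_reals all_analysis.
From mathcomp Require Import ring lra zify.
Import Order.TTheory GRing.Theory Num.Theory.
Local Open Scope ring_scope.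

(** The GCD form is multiplicative over products of systems with coprime
    supports, so it suffices to multiply together many small systems.  For a set
    [Q] of primes with [sigma = \sum_(p in Q) 1/p], the system [{1} \cup Q] with
    weights [1] and [(p sigma)^(-1/2)] has quotient at least [1 + sqrt sigma].

    Write [L = ln N], [l = ln L], [lam = ln l].  For [1 <= k <= l^g], the primes in
    [(B^k X, B^(k+1) X]], where [X] is about [L l / lam], are cut greedily into
    [r_k], about [L / (c k^2 lam)], disjoint sets with [sigma] at least
    [eta_k = (g c k)^2 lam / (L l)], where [c = ln B + 2].  Mertens' first theorem
    provides enough primes once [B] is large.  The number of integers is at most
    [exp (\sum_k r_k (k c + O(1))) <= N], and the quotient is at least
    [exp (g \sum_k r_k sqrt eta_k)], with
    [g \sum_k r_k sqrt eta_k >= g^4 sqrt (L lam / l)].  Since [g < 1] is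
    arbitrary, any [gamma < 1] is reached.  Fewer than [N] integers are completed
    to exactly [N] using very small weights. *)

(** * Mertens' first theorem *)

Lemma ln_nat_prod (R : realType) (I : Type) (r : seq I) (P : pred I) (F : I -> nat) :
  (forall i, P i -> (0 < F i)%N) ->
  ln (\prod_(i <- r | P i) F i)%:R = \sum_(i <- r | P i) ln (F i)%:R :> R.
Proof.
move=> F0.
suff [] : ln (\prod_(i <- r | P i) F i)%:R = \sum_(i <- r | P i) ln (F i)%:R :> R
  /\ (0 < \prod_(i <- r | P i) F i)%N by [].
apply: (big_rec2 (fun (y1 : R) (y2 : nat) => ln y2%:R = y1 /\ (0 < y2)%N)) => [|i y1 y2 Pi [<- y20]].
  by rewrite ln1.
by rewrite natrM lnM ?posrE ?ltr0n ?muln_gt0 ?F0.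
Qed.

Lemma ln_nat_ge0 (R : realType) (n : nat) : 0 <= ln n%:R :> R.
Proof. by case: n => [|n]; [rewrite ln0|rewrite ln_ge0 // ler1n]. Qed.

Lemma ln_prime_factors (R : realType) (n M : nat) : (0 < n)%N -> (n <= M)%N ->
  ln n%:R = \sum_(0 <= p < M.+1 | prime p) (logn p n)%:R * ln p%:R :> R.
Proof.
move=> n0 nM.
rewrite -{1}(partnT n0) (widen_partn _ nM) ln_nat_prod; last first.
  move=> p _; case: (posnP p) => [->|p0]; last by rewrite expn_gt0 p0.
  by rewrite lognE.
rewrite [RHS]big_mkcond [LHS]big_mkcond; apply: eq_bigr => p _ /=.
case: ifPn => [pp|/negPf pp]; last by rewrite lognE pp expn0 ln1.
by rewrite natrX lnXn ?ltr0n ?prime_gt0 // mulr_natl.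
Qed.

Lemma le_ln_prime_factors (R : realType) (n M : nat) : (0 < n)%N ->
  \sum_(0 <= p < M | prime p) (logn p n)%:R * ln p%:R <= ln n%:R :> R.
Proof.
move=> n0; rewrite (@ln_prime_factors R n (maxn n M)) ?leq_maxl //.
rewrite [leRHS](big_cat_nat (n:=M)) //=; last by rewrite leqW // leq_maxr.
by rewrite lerDl; apply: sumr_ge0 => p _; rewrite mulr_ge0 // ln_nat_ge0.
Qed.

Lemma prime_dvd_fact (p n : nat) : prime p -> (p %| n`!)%N = (p <= n)%N.
Proof.
move=> pp; apply/idP/idP => [|pn]; last by rewrite dvdn_fact // prime_gt0.
elim: n => [|n IH]; first by rewrite dvdn1 => /eqP p1; rewrite p1 in pp.
by rewrite factS Euclid_dvdM // => /orP[/dvdn_leq->|/IH/leqW].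
Qed.

Definition theta (R : realType) (n : nat) : R := \sum_(0 <= p < n.+1 | prime p) ln p%:R.

(** Chebyshev's argument: every prime in [(n, 2n]] divides the central binomial coefficient, which
    is at most [2 ^ (2n)]. *)
Lemma theta_double (R : realType) (n : nat) :
  theta R (n + n) <= theta R n + (n + n)%:R * ln 2.
Proof.
have C0 : (0 < 'C(n + n, n))%N by rewrite bin_gt0 leq_addr.
(* The coefficient is one term of the expansion of [(1 + 1) ^ (n + n)]. *)
have le4 : ln ('C(n + n, n))%:R <= (n + n)%:R * ln 2 :> R.
  rewrite mulr_natl -lnXn ?ltr0n // -natrX ler_ln ?posrE ?ltr0n ?expn_gt0 //.
  rewrite ler_nat -[2%N]/(1 + 1)%N expnDn (bigD1 (inord n)) //=.
  by rewrite inordK ?ltnS ?leq_addr // !exp1n !muln1 leq_addr.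
rewrite /theta [leLHS](big_cat_nat (n:=n.+1)) //=; last by rewrite ltnS leq_addr.
rewrite lerD2l; apply: le_trans le4.
apply: le_trans (@le_ln_prime_factors R _ (n + n).+1 C0).
rewrite [leRHS](big_cat_nat (n:=n.+1)) //=; last by rewrite ltnS leq_addr.
rewrite -[leLHS]add0r; apply: lerD.
  by apply: sumr_ge0 => p _; rewrite mulr_ge0 // ln_nat_ge0.
rewrite big_nat_cond [leRHS]big_nat_cond.
apply: ler_sum => p /andP[/andP[np pnn] pp].
rewrite -[leLHS]mul1r ler_wpM2r ?ln_nat_ge0 // ler1n logn_gt0 mem_primes pp C0 /=.
(* [p] divides [(n + n)!], the product of the coefficient with [n! * n!], but [p > n] keeps it from
   dividing [n!]. *)
have := bin_fact (leq_addr n n); rewrite addnK => E.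
have : (p %| (n + n)`!)%N by rewrite dvdn_fact // prime_gt0.
rewrite -E Euclid_dvdM // => /orP[//|].
by rewrite Euclid_dvdM // orbb prime_dvd_fact // leqNgt np.
Qed.

(** Strong induction by halving. Doubling [k] costs [2k] and so gives [6k] where [8k] is allowed;
    for an odd argument the slack [2k] pays for the one extra logarithm. *)
Lemma theta_le (R : realType) (n : nat) : theta R n <= 4 * n%:R.
Proof.
have ln2 : ln 2 <= 1 :> R.
  by apply: le_trans (@le_ln1Dx R 1 _) => //; apply: lt_trans ltr01; rewrite oppr_lt0.
have [m] := ubnP n; elim: m n => // m IH n; rewrite ltnS => nm.
case: n nm => [_|n nm]; first by rewrite /theta big_mkcond big_nat1 mulr0.
have small k : theta R (k + k) <= theta R k + (k + k)%:R.
  by apply: le_trans (theta_double R k) _; rewrite lerD2l ler_piMr.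
have Hk : (n./2 < m)%N by lia.
have En := odd_double_half n; rewrite -addnn in En.
case: (boolP (odd n)) En => _ /= En.
  have {}En : n.+1 = (n./2.+1 + n./2.+1)%N by lia.
  have km : (n./2.+1 < m)%N by lia.
  rewrite En; apply: le_trans (small _) _.
  have := IH _ km; have := ler0n R (n./2.+1); rewrite natrD.
  by move: ((n./2.+1)%:R : R) (theta R _) => *; lra.
rewrite add0n in En.
rewrite /theta big_mkcond big_nat_recr //= -big_mkcond -/(theta R n).
have H1 : theta R n <= 4 * (n./2)%:R + n%:R.
  by rewrite -En; apply: le_trans (small _) _; rewrite lerD2r En IH.
have H2 : n%:R = (n./2)%:R + (n./2)%:R :> R by rewrite -natrD En.
have H3 : (if prime n.+1 then ln n.+1%:R else 0) <= 1 + n%:R :> R.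
  case: ifP => _; last by rewrite -(natrD R 1 n) ler0n.
  by rewrite nat1r ltW // ln_sublinear // ltr0n.
apply: le_trans (lerD H1 H3) _; rewrite -nat1r H2; have := ler0n R (n./2); lra.
Qed.

Definition mertens (R : realType) (n : nat) : R :=
  \sum_(0 <= p < n.+1 | prime p) ln p%:R / p%:R.

(** The single term [n ^ n / n!] of the exponential series is at most [exp n]. *)
Lemma ln_fact_ge (R : realType) (n : nat) : n%:R * ln n%:R - n%:R <= ln (n`!)%:R :> R.
Proof.
case: n => [|n]; first by rewrite mul0r subr0 ln1.
have n0 : 0 < n.+1%:R :> R by rewrite ltr0n.
have f0 : 0 < (n.+1)`!%:R :> R by rewrite ltr0n fact_gt0.
have := @expR_ge1Dxn R n.+1%:R n (ltW n0).
have e0 : 0 < n.+1%:R ^+ n.+1 / (n.+1)`!%:R :> R by rewrite divr_gt0 // exprn_gt0.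
move=> H; have {}H : n.+1%:R ^+ n.+1 / (n.+1)`!%:R <= expR n.+1%:R :> R.
  by apply: le_trans H; rewrite lerDr.
move: H; rewrite -ler_ln ?posrE ?expR_gt0 // expRK ln_div ?posrE ?exprn_gt0 //.
by rewrite lnXn // -mulr_natl; lra.
Qed.

Lemma logn_fact_le (R : realType) (p n : nat) : prime p ->
  (logn p n`!)%:R <= n%:R / (p%:R - 1) :> R.
Proof.
move=> pp; have p1 : 1 < p%:R :> R by rewrite ltr1n prime_gt1.
have p0 : 0 < p%:R :> R by rewrite ltr0n prime_gt0.
rewrite logn_fact //.
(* Legendre's sum is compared with the exact partial geometric sum, since the limit value
   [n / (p - 1)] does not carry an induction. *)
suff H m : (\sum_(1 <= k < m.+1) n %/ p ^ k)%:R <= n%:R * (1 - (p%:R ^+ m)^-1) / (p%:R - 1) :> R.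
  apply: le_trans (H n) _; rewrite ler_pM2r ?invr_gt0 ?subr_gt0 //.
  by rewrite ler_piMr // gerBl invr_ge0 exprn_ge0 // ltW.
elim: m => [|m IH]; first by rewrite big_geq // expr0 invr1 subrr mulr0 mul0r.
have Hm : (n %/ p ^ m.+1)%:R <= n%:R / p%:R ^+ m.+1 :> R.
  rewrite -(@ler_pM2r _ (p%:R ^+ m.+1)) ?exprn_gt0 // -natrX -natrM mulfVK.
    by rewrite ler_nat leq_trunc_div.
  by rewrite natrX expf_neq0 // lt0r_neq0.
rewrite big_nat_recr //= natrD; apply: le_trans (lerD IH Hm) _.
rewrite exprS; have : p%:R ^+ m != 0 :> R by rewrite expf_neq0 // lt0r_neq0.
move: (p%:R ^+ m : R) => y y0; rewrite le_eqVlt; apply/orP; left; apply/eqP.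
have p0' := lt0r_neq0 p0; have q0 : p%:R - 1 != 0 :> R by rewrite subr_eq0 gt_eqF.
by field; rewrite ?y0 ?p0' ?q0.
Qed.

Lemma ln_fact_prime_sum (R : realType) (n : nat) :
  ln (n`!)%:R = \sum_(0 <= p < n.+1 | prime p) (logn p n`!)%:R * ln p%:R :> R.
Proof.
rewrite (@ln_prime_factors R _ (maxn n n`!)) ?fact_gt0 ?leq_maxr //.
rewrite (big_cat_nat (n:=n.+1)) //=; last by rewrite ltnS leq_maxl.
rewrite [X in _ + X]big_nat_cond [X in _ + X]big1 ?addr0 // => p /andP[/andP[np _] pp].
by rewrite lognE pp fact_gt0 prime_dvd_fact // leqNgt np mul0r.
Qed.

(** By Legendre, [n / p] is at most one more than the exponent of [p] in [n!]. Weighting by [ln p]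
    and summing, the ones add up to [theta R n], whence the constant 4. *)
Lemma mertens_le (R : realType) (n : nat) : (0 < n)%N -> mertens R n <= ln n%:R + 4.
Proof.
move=> n0; have n0' : 0 < n%:R :> R by rewrite ltr0n.
have H : n%:R * mertens R n <= ln (n`!)%:R + theta R n.
  rewrite ln_fact_prime_sum /theta /mertens -big_split mulr_sumr /=.
  apply: ler_sum => p pp; rewrite mulrCA mulrC -[X in _ + X]mul1r -mulrDl.
  rewrite ler_wpM2r ?ln_nat_ge0 // ler_pdivrMr ?ltr0n ?prime_gt0 //.
  rewrite natr1 -natrM ler_nat.
  have : (n %/ p <= logn p n`!)%N by rewrite logn_fact // big_nat_recl //= expn1 leq_addr.
  have := ltn_ceil n (prime_gt0 pp); nia.
have lnf : ln (n`!)%:R <= n%:R * ln n%:R :> R.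
  rewrite mulr_natl -lnXn // ler_ln ?posrE ?exprn_gt0 ?ltr0n ?fact_gt0 // -natrX ler_nat.
  elim: {n0 n0' H} n => // n IH; rewrite factS expnS leq_mul2l /=.
  by case: n IH => // n IH; apply: leq_trans IH _; rewrite leq_exp2r.
rewrite -(ler_pM2l n0'); apply: le_trans H _.
by apply: le_trans (lerD lnf (theta_le R n)) _; rewrite mulrDr (mulrC 4).
Qed.

Lemma sum_ln_over_square_le (R : realType) (n : nat) :
  \sum_(2 <= m < n.+1) ln m%:R / (m%:R * (m%:R - 1)) <= 2 :> R.
Proof.
(* [f (m + 1) - f m] dominates the term of index [m + 1]. *)
pose f (m : nat) : R := - ((ln m%:R + 2) / m%:R).
case: (leqP n 0) => [|n0]; first by rewrite leqn0 => /eqP->; rewrite big_geq.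
have H : \sum_(1 <= m < n) ln m.+1%:R / (m.+1%:R * (m.+1%:R - 1)) <= f n - f 1%N.
  rewrite -telescope_sumr //; rewrite big_nat_cond [leRHS]big_nat_cond.
  apply: ler_sum => m /andP[/andP[m0 _] _]; rewrite /f.
  have m0' : 0 < m%:R :> R by rewrite ltr0n.
  have m1' : 1 <= m%:R :> R by rewrite ler1n.
  have : ln m.+1%:R <= ln m%:R + m%:R^-1 :> R.
    have -> : m.+1%:R = m%:R * (1 + m%:R^-1) :> R by rewrite mulrDr mulr1 divff ?lt0r_neq0 // natr1.
    have i0 : 0 < m%:R^-1 :> R by rewrite invr_gt0.
    rewrite lnM ?posrE ?addr_gt0 // lerD2l le_ln1Dx //; lra.
  rewrite -nat1r; move: (ln (1 + _)) (ln m%:R) m0' m1' => a c m0' m1' ac.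
  move: (m%:R : R) m0' m1' ac => x x0 x1' ac.
  have -> : a / ((1 + x) * (1 + x - 1)) = (a / ((1 + x) * x)) by rewrite addrAC subrr add0r.
  rewrite -subr_ge0.
  have -> : - ((a + 2) / (1 + x)) - - ((c + 2) / x) - a / ((1 + x) * x) =
    (((c + x^-1 - a) * (1 + x) + (1 - x^-1))) / ((1 + x) * x).
    by field; rewrite !lt0r_neq0 //; lra.
  have x1 : 0 <= 1 - x^-1.
    by rewrite subr_ge0 invf_le1.
  apply: divr_ge0; last by apply: mulr_ge0; lra.
  by apply: addr_ge0 => //; apply: mulr_ge0; lra.
rewrite big_add1; apply: le_trans H _.
by rewrite /f ln1 add0r divr1 opprK gerDr oppr_le0 divr_ge0 // addr_ge0 // ln_nat_ge0.
Qed.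

(** The exponent of [p] in [n!] is at most [n / (p - 1)], and
    [1 / (p - 1) = 1 / p + 1 / (p (p - 1))]. The second part contributes at most 2 and the lower
    bound for [ln n!] loses 1, hence 3. *)
Lemma mertens_ge (R : realType) (n : nat) : (0 < n)%N -> ln n%:R - 3 <= mertens R n.
Proof.
move=> n0; have n0' : 0 < n%:R :> R by rewrite ltr0n.
have H : ln (n`!)%:R <= n%:R * (mertens R n +
    \sum_(2 <= m < n.+1) ln m%:R / (m%:R * (m%:R - 1))).
  rewrite ln_fact_prime_sum.
  apply: (@le_trans _ _ (n%:R * (mertens R n +
     \sum_(0 <= p < n.+1 | prime p) ln p%:R / (p%:R * (p%:R - 1))))).
    rewrite /mertens -big_split mulr_sumr /=; apply: ler_sum => p pp.
    have p1 : 1 < p%:R :> R by rewrite ltr1n prime_gt1.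
    have -> : n%:R * (ln p%:R / p%:R + ln p%:R / (p%:R * (p%:R - 1))) =
       n%:R / (p%:R - 1) * ln p%:R :> R.
      by field; rewrite !lt0r_neq0 //; lra.
    by rewrite ler_wpM2r ?ln_nat_ge0 // logn_fact_le.
  rewrite ler_pM2l // lerD2l.
  case: n n0 {n0'} => // n _.
  (* The indices 0 and 1 are not prime; from 2 on, the sum over primes is enlarged to all
     integers. *)
  rewrite (big_cat_nat (n:=2)) //= [X in X + _]big_mkcond /= big_nat_recr //= big_nat1 /=.
  rewrite !addr0 add0r big_mkcond big_nat [leRHS]big_nat.
  apply: ler_sum => m /andP[m2 _]; case: ifP => // _.
  by rewrite divr_ge0 ?ln_nat_ge0 // mulr_ge0 // subr_ge0 ler1n (leq_trans _ m2).
have := sum_ln_over_square_le R n; move: H => /(le_trans (ln_fact_ge R n)) H1 H2.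
rewrite -(ler_pM2l n0') mulrBr; move: H1 H2.
move: (mertens R n) (\sum_(2 <= m < n.+1) _) => M S H1 H2.
have : n%:R * S <= n%:R * 2 by rewrite ler_pM2l.
by move: H1; rewrite mulrDr; lra.
Qed.

(** For [p <= y], [1 / p] is at least [(ln p / p) / ln y]. Subtracting the two Mertens bounds loses
    [4 + 3 = 7]. *)
Lemma sum_inv_primes_ge (R : realType) (x y : nat) : (0 < x)%N -> (x <= y)%N -> (1 < y)%N ->
  (ln y%:R - ln x%:R - 7) / ln y%:R <= \sum_(x.+1 <= p < y.+1 | prime p) p%:R^-1 :> R.
Proof.
move=> x0 xy y1; have y0 := leq_trans x0 xy.
have ly : 0 < ln y%:R :> R by rewrite ln_gt0 // ltr1n.
rewrite ler_pdivrMr //.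
have := mertens_ge R y y0; have := mertens_le R x x0.
rewrite /mertens [\sum_(0 <= p < y.+1 | _) _](big_cat_nat (n:=x.+1)) //=.
move=> H1 H2; apply: (@le_trans _ _ (\sum_(x.+1 <= i < y.+1 | prime i) ln i%:R / i%:R)).
  by move: H1 H2; lra.
rewrite mulr_suml big_nat_cond [leRHS]big_nat_cond.
apply: ler_sum => p /andP[/andP[xp py] pp]; rewrite mulrC ler_wpM2l ?invr_ge0 //.
by rewrite ler_ln ?posrE ?ltr0n ?ler_nat // prime_gt0.
Qed.

(** * GCD forms of weighted systems *)

Definition gcd_kernel (R : realType) (m n : nat) : R :=
  (gcdn m n)%:R / Num.sqrt (m * n)%:R.

Definition sq_weight {R : realType} (s : seq (nat * R)) : R :=
  \sum_(a <- s) a.2 ^+ 2.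

(** Kept bilinear, so that the form of a concatenation splits into blocks. *)
Definition gcd_form {R : realType} (s t : seq (nat * R)) : R :=
  \sum_(a <- s) \sum_(b <- t) a.2 * b.2 * gcd_kernel R a.1 b.1.

Definition tensor {R : realType} (s t : seq (nat * R)) : seq (nat * R) :=
  [seq ((a.1 * q.1)%N, a.2 * q.2) | a <- s, q <- t].

(** After division by [gcdn a b * gcdn q r], each cofactor of [a] and [q] is coprime to each
    cofactor of [b] and [r]. *)
Lemma gcdn_mul_coprime (a q b r : nat) : (0 < a)%N -> (0 < q)%N ->
  coprime a r -> coprime b q -> gcdn (a * q) (b * r) = (gcdn a b * gcdn q r)%N.
Proof.
move=> a0 q0 ar bq.
have d0 : (0 < gcdn a b)%N by rewrite gcdn_gt0 a0.
have e0 : (0 < gcdn q r)%N by rewrite gcdn_gt0 q0.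
have H m n : (0 < gcdn m n)%N -> coprime (m %/ gcdn m n) (n %/ gcdn m n).
  move=> g0; rewrite /coprime -(eqn_pmul2r g0) mul1n muln_gcdl.
  by rewrite !divnK ?dvdn_gcdl ?dvdn_gcdr.
have Ea := divnK (dvdn_gcdl a b); have Eb := divnK (dvdn_gcdr a b).
have Eq := divnK (dvdn_gcdl q r); have Er := divnK (dvdn_gcdr q r).
have -> : (a * q = a %/ gcdn a b * (q %/ gcdn q r) * (gcdn a b * gcdn q r))%N.
  by rewrite mulnACA Ea Eq.
have -> : (b * r = b %/ gcdn a b * (r %/ gcdn q r) * (gcdn a b * gcdn q r))%N.
  by rewrite mulnACA Eb Er.
rewrite -muln_gcdl.
rewrite (_ : gcdn _ _ = 1)%N ?mul1n //; apply/eqP; rewrite -/(coprime _ _).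
have q1 : (q %/ gcdn q r %| q)%N by apply/dvdnP; exists (gcdn q r); rewrite mulnC Eq.
have r1 : (r %/ gcdn q r %| r)%N by apply/dvdnP; exists (gcdn q r); rewrite mulnC Er.
have a1 : (a %/ gcdn a b %| a)%N by apply/dvdnP; exists (gcdn a b); rewrite mulnC Ea.
have b1 : (b %/ gcdn a b %| b)%N by apply/dvdnP; exists (gcdn a b); rewrite mulnC Eb.
rewrite coprimeMl !coprimeMr !H //= andbT (coprime_dvdl a1) ?(coprime_dvdr r1) //=.
by rewrite coprime_sym (coprime_dvdl b1) ?(coprime_dvdr q1).
Qed.

Lemma gcd_kernel_mul (R : realType) (a q b r : nat) : (0 < a)%N -> (0 < q)%N ->
  coprime a r -> coprime b q ->
  gcd_kernel R (a * q) (b * r) = gcd_kernel R a b * gcd_kernel R q r.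
Proof.
move=> a0 q0 ar bq; rewrite /gcd_kernel gcdn_mul_coprime //.
rewrite mulnACA !natrM [Num.sqrt (_ * _ * _)]sqrtrM ?mulr_ge0 // invfM mulrACA //.
Qed.

Lemma sq_weight_tensor {R : realType} (s t : seq (nat * R)) :
  sq_weight (tensor s t) = sq_weight s * sq_weight t.
Proof.
rewrite /sq_weight /tensor big_allpairs_dep big_distrlr.
by apply: eq_bigr => a _; apply: eq_bigr => q _; rewrite /= exprMn.
Qed.

Lemma gcd_form_tensor {R : realType} (s t : seq (nat * R)) :
  (forall a, a \in s -> (0 < a.1)%N) -> (forall q, q \in t -> (0 < q.1)%N) ->
  (forall a q, a \in s -> q \in t -> coprime a.1 q.1) ->
  gcd_form (tensor s t) (tensor s t) = gcd_form s s * gcd_form t t.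
Proof.
move=> sp tp co; rewrite /gcd_form /tensor big_allpairs_dep mulr_suml /=.
rewrite big_seq [RHS]big_seq; apply: eq_bigr => a sa.
transitivity (\sum_(q <- t) (\sum_(b <- s) a.2 * b.2 * gcd_kernel R a.1 b.1) *
   \sum_(r <- t) q.2 * r.2 * gcd_kernel R q.1 r.1); last by rewrite mulr_sumr.
rewrite big_seq [RHS]big_seq; apply: eq_bigr => q tq.
rewrite big_allpairs_dep mulr_suml big_seq [RHS]big_seq; apply: eq_bigr => b sb.
rewrite mulr_sumr big_seq [RHS]big_seq; apply: eq_bigr => r tr /=.
by rewrite gcd_kernel_mul ?co //; [ring|apply: sp|apply: tp].
Qed.

(** Factors are recovered from products: if [a q = a' q'] then [a] divides [a' q'] and is coprime to
    [q'], so [a] divides [a']; the other divisibilities are symmetric. *)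
Lemma uniq_tensor {R : realType} (s t : seq (nat * R)) :
  (forall a q, a \in s -> q \in t -> coprime a.1 q.1) ->
  uniq (map fst s) -> uniq (map fst t) -> uniq (map fst (tensor s t)).
Proof.
move=> co us ut.
have -> : map fst (tensor s t) = [seq (m * n)%N | m <- map fst s, n <- map fst t].
  by rewrite /tensor map_allpairs allpairs_mapl allpairs_mapr.
apply: allpairs_uniq => // -[m n] [m' n'] /allpairsP[[x y] /= [xs yt [-> ->]]].
move=> /allpairsP[[x' y'] /= [xs' yt' [-> ->]]] E.
move/mapP: xs => [a sa ax]; move/mapP: yt => [q tq qy].
move/mapP: xs' => [a' sa' ax']; move/mapP: yt' => [q' tq' qy'].
subst x y x' y'.
have := dvdn_mulr q.1 (dvdnn a.1); rewrite E Gauss_dvdl ?co // => d1.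
have := dvdn_mulr q'.1 (dvdnn a'.1); rewrite -E Gauss_dvdl ?co // => d2.
have := dvdn_mull a.1 (dvdnn q.1); rewrite E Gauss_dvdr 1?coprime_sym ?co // => d3.
have := dvdn_mull a'.1 (dvdnn q'.1); rewrite -E Gauss_dvdr 1?coprime_sym ?co // => d4.
have /eqP -> : a.1 == a'.1 by rewrite eqn_dvd d1.
by have /eqP -> : q.1 == q'.1 by rewrite eqn_dvd d3.
Qed.

(** The weights are proportional to the kernel entries [1 / sqrt p] between 1 and [p], scaled so
    that the primes together carry the same square weight as the centre 1. *)
Definition prime_star (R : realType) (Q : seq nat) : seq (nat * R) :=
  (1%N, 1) :: [seq (p, Num.sqrt (p%:R^-1 / \sum_(p <- Q) p%:R^-1)) | p <- Q].

Lemma sq_weight_star (R : realType) (Q : seq nat) :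
  0 < \sum_(p <- Q) p%:R^-1 :> R -> sq_weight (prime_star R Q) = 2.
Proof.
move=> s0; rewrite /sq_weight big_cons big_map /= expr1n.
under eq_bigr do rewrite sqr_sqrtr ?divr_ge0 ?invr_ge0 ?(ltW s0) //.
by rewrite -mulr_suml divff // lt0r_neq0.
Qed.

Lemma gcd_kernel_ge0 (R : realType) (m n : nat) : 0 <= gcd_kernel R m n.
Proof. by rewrite divr_ge0 ?sqrtr_ge0. Qed.

Lemma gcd_kernelC (R : realType) (m n : nat) : gcd_kernel R m n = gcd_kernel R n m.
Proof. by rewrite /gcd_kernel gcdnC mulnC. Qed.

Lemma gcd_kernel_diag (R : realType) (n : nat) : (0 < n)%N -> gcd_kernel R n n = 1.
Proof.
move=> n0; rewrite /gcd_kernel gcdnn natrM -expr2 sqrtr_sqr ger0_norm // divff //.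
by rewrite pnatr_eq0 -lt0n.
Qed.

(** The diagonal gives [1 + 1], the pairs of the centre with a prime give [sqrt S] twice, and the
    pairs of distinct primes are nonnegative and dropped. *)
Lemma gcd_form_star (R : realType) (Q : seq nat) :
  uniq Q -> all prime Q -> 0 < \sum_(p <- Q) p%:R^-1 :> R ->
  2 * (1 + Num.sqrt (\sum_(p <- Q) p%:R^-1)) <= gcd_form (prime_star R Q) (prime_star R Q).
Proof.
move=> uQ /allP Qp s0; rewrite /gcd_form big_cons big_cons /= big_map.
rewrite big_map /= !mul1r gcd_kernel_diag //.
set S := \sum_(p <- Q) p%:R^-1 : R in s0 *.
have E : \sum_(j <- Q) 1 * Num.sqrt (j%:R^-1 / S) * gcd_kernel R 1 j = Num.sqrt S.
  transitivity (\sum_(j <- Q) j%:R^-1 / Num.sqrt S).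
    apply: eq_bigr => p _; rewrite mul1r /gcd_kernel gcd1n mul1n mul1r.
    rewrite sqrtrM ?invr_ge0 // sqrtrV // mulrAC -expr2 exprVn sqr_sqrtr //.
    by rewrite sqrtrV ?ltW.
  rewrite -mulr_suml -/S -{1}(sqr_sqrtr (ltW s0)) expr2 mulfK //.
  by rewrite gt_eqF // sqrtr_gt0.
(* The subtracted [Num.sqrt S] is the column of the centre; what remains of the row of [p] is at
   least its diagonal entry. *)
have E2 : 1 <= \sum_(p <- Q) \sum_(b <- prime_star R Q)
    Num.sqrt (p%:R^-1 / S) * b.2 * gcd_kernel R p b.1 - Num.sqrt S.
  rewrite -E -sumrB.
  apply: (@le_trans _ _ (\sum_(p <- Q) p%:R^-1 / S)).
    by rewrite -mulr_suml divff // lt0r_neq0.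
  rewrite big_seq [leRHS]big_seq; apply: ler_sum => p pQ.
  rewrite big_cons /= mulr1 mul1r gcd_kernelC addrAC subrr add0r big_map /=.
  rewrite (bigD1_seq p) //= gcd_kernel_diag ?prime_gt0 ?Qp // mulr1 -expr2.
  rewrite sqr_sqrtr ?divr_ge0 ?invr_ge0 ?(ltW s0) //. rewrite lerDl.
  by apply: sumr_ge0 => q _; rewrite !mulr_ge0 ?sqrtr_ge0 ?gcd_kernel_ge0.
by rewrite E; lra.
Qed.

(** Induction on [Qs], tensoring with one star at a time. The clause on prime divisors is what shows
    that the new star has support coprime to the system already built. *)
Lemma chunk_system (R : realType) (Qs : seq (seq nat)) :
  uniq (flatten Qs) -> all prime (flatten Qs) ->
  all (fun Q => 0 < \sum_(p <- Q) p%:R^-1 :> R) Qs ->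
  exists s : seq (nat * R),
    [/\ uniq (map fst s), (forall a, a \in s -> (0 < a.1)%N /\ 0 < a.2),
        (forall a p, a \in s -> prime p -> (p %| a.1)%N -> p \in flatten Qs),
        size s = (\prod_(Q <- Qs) (size Q).+1)%N &
        0 < sq_weight s /\ sq_weight s *
          \prod_(Q <- Qs) (1 + Num.sqrt (\sum_(p <- Q) p%:R^-1)) <= gcd_form s s].
Proof.
elim: Qs => [_ _ _|Q Qs IH] /=.
  exists [:: (1%N, 1)]; split => //.
  - by move=> a; rewrite inE => /eqP->.
  - move=> a p; rewrite inE => /eqP-> /= pp; rewrite dvdn1 => /eqP p1.
    by rewrite p1 in pp.
  - by rewrite big_nil.
  - rewrite /sq_weight /gcd_form !big_seq1 big_nil /= expr1n gcd_kernel_diag // !mulr1.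
    by rewrite ltr01.
rewrite cat_uniq all_cat => /and3P[uQ /hasPn dQ uQs] /andP[Qp Qsp] /andP[s0 Qs0].
have [s [us sp sd ss [sq0 sf]]] := IH uQs Qsp Qs0.
have tE q : q \in prime_star R Q -> q.1 = 1%N /\ q.2 = 1 \/ q.1 \in Q /\ 0 < q.2.
  rewrite inE => /orP[/eqP->|/mapP[p pQ ->]]; [by left|right => /=].
  split=> //; rewrite sqrtr_gt0 divr_gt0 // invr_gt0 ltr0n.
  by rewrite prime_gt0 // (allP Qp).
have tp q : q \in prime_star R Q -> (0 < q.1)%N.
  by case/tE => [[-> _]//|[qQ _]]; rewrite prime_gt0 // (allP Qp).
have co a q : a \in s -> q \in prime_star R Q -> coprime a.1 q.1.
  move=> sa /tE[[-> _]|[qQ _]]; first exact: coprimen1.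
  have qp : prime q.1 by rewrite (allP Qp).
  rewrite coprime_sym prime_coprime //; apply/negP => /(sd _ _ sa qp) /dQ /=.
  by rewrite qQ.
have uS : uniq (map fst (prime_star R Q)).
  rewrite /= -map_comp map_id_in ?uQ ?andbT //; apply/negP.
  by move=> /(allP Qp).
exists (tensor s (prime_star R Q)); split.
- exact: uniq_tensor.
- move=> _ /allpairsP[[a q] /= [sa tq ->]] /=; have [a1 a2] := sp _ sa.
  rewrite muln_gt0 a1 tp //; split=> //; rewrite mulr_gt0 //.
  by case: (tE _ tq) => [[_ ->]|[]].
- move=> _ p /allpairsP[[a q] /= [sa tq ->]] /= pp; rewrite mem_cat Euclid_dvdM //.
  case/orP=> [/(sd _ _ sa pp)->|]; first by rewrite orbT.
  case: (tE _ tq) => [[-> _]|[qQ _]].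
    by rewrite dvdn1 => /eqP p1; rewrite p1 in pp.
  rewrite dvdn_prime2 //; last by rewrite (allP Qp).
  by move=> /eqP->; rewrite qQ.
- by rewrite size_allpairs ss big_cons /= size_map mulnC.
- rewrite sq_weight_tensor sq_weight_star // gcd_form_tensor //; last first.
    by move=> a /sp[].
  split; first by rewrite mulr_gt0.
  rewrite big_cons; set P := \prod_(Q <- Qs) _.
  have P0 : 0 <= P by apply: prodr_ge0 => A _; rewrite addr_ge0 ?sqrtr_ge0.
  apply: (@le_trans _ _ (sq_weight s * P * (2 * (1 + Num.sqrt (\sum_(p <- Q) p%:R^-1))))).
    by rewrite le_eqVlt; apply/orP; left; apply/eqP; ring.
  apply: ler_pM => //; first by apply: mulr_ge0 => //; apply: ltW.
  exact: gcd_form_star.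
Qed.

Lemma gcd_system_fill (R : realType) (N : nat) (s : seq (nat * R)) (rho : R) :
  uniq (map fst s) -> (forall a, a \in s -> (0 < a.1)%N /\ 0 < a.2) ->
  (size s <= N)%N -> 0 < rho -> sq_weight s * rho < gcd_form s s ->
  exists t : seq (nat * R),
    [/\ uniq (map fst t), (forall a, a \in t -> (0 < a.1)%N /\ 0 < a.2),
        size t = N & sq_weight t * rho <= gcd_form t t].
Proof.
move=> us sp sN r0 H; set D := gcd_form s s - sq_weight s * rho.
have D0 : 0 < D by rewrite subr_gt0.
(* With this weight at most [N] new entries raise the left side by at most the slack [D]; [N.+1]
   keeps the denominator positive. *)
pose e : R := Num.sqrt (D / (N.+1%:R * rho)).
have e0 : 0 < e by rewrite sqrtr_gt0 divr_gt0 // mulr_gt0 // ltr0n.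
(* A crude bound for every integer of [s]: the integers after [M] are new. *)
pose M := (\sum_(a <- s) a.1)%N.
pose f := [seq ((M + i).+1, e) | i <- iota 0 (N - size s)].
exists (s ++ f); split.
- rewrite map_cat cat_uniq us /=; apply/andP; split.
    apply/hasPn => x /mapP[_ /mapP[i _ ->] ->] /=; apply/negP => /mapP[a sa /= E].
    have : (a.1 <= M)%N by rewrite /M (big_rem a) //= leq_addr.
    by rewrite -E ltnNge leq_addr.
  rewrite -map_comp map_inj_uniq ?iota_uniq // => i j /= [/addnI]; exact.
- by move=> a; rewrite mem_cat => /orP[/sp//|/mapP[i _ ->]].
- by rewrite size_cat size_map size_iota subnKC.
- have -> : sq_weight (s ++ f) = sq_weight s + (N - size s)%:R * e ^+ 2.
    rewrite /sq_weight big_cat /= big_map /=; congr (_ + _).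
    by rewrite big_const_seq count_predT size_iota iter_addr_0 mulr_natl.
  have H1 : (N - size s)%:R * e ^+ 2 * rho <= D.
    rewrite sqr_sqrtr ?divr_ge0 ?mulr_ge0 ?(ltW D0) ?(ltW r0) //.
    have -> : (N - size s)%:R * (D / (N.+1%:R * rho)) * rho =
      D * ((N - size s)%:R / N.+1%:R).
      by field; rewrite (lt0r_neq0 r0) nat1r pnatr_eq0.
    by rewrite ler_piMr ?(ltW D0) // ler_pdivrMr ?ltr0n // mul1r ler_nat leqW // leq_subr.
  have pos t u : (forall a, a \in t -> 0 < a.2) -> (forall a, a \in u -> 0 < a.2) ->
      0 <= gcd_form t u :> R.
    move=> tp up; rewrite /gcd_form big_seq; apply: sumr_ge0 => a ta.
    rewrite big_seq; apply: sumr_ge0 => b ub.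
    apply: mulr_ge0; last exact: gcd_kernel_ge0.
    by apply: mulr_ge0; apply: ltW; [apply: tp|apply: up].
  have sp2 a : a \in s -> 0 < a.2 by move=> /sp[].
  have fp2 a : a \in f -> 0 < a.2 by move=> /mapP[i _ ->].
  have -> : gcd_form (s ++ f) (s ++ f) =
    gcd_form s s + (gcd_form s f + gcd_form f (s ++ f)).
    rewrite /gcd_form big_cat /= addrA; congr (_ + _).
    by rewrite -big_split; apply: eq_bigr => a _; rewrite big_cat.
  have P1 := pos _ _ sp2 fp2.
  have P2 : 0 <= gcd_form f (s ++ f).
    by apply: pos => // a; rewrite mem_cat => /orP[/sp2|/fp2].
  by move: H1 P1 P2; rewrite /D mulrDl; lra.
Qed.

(** Sorting by the integers gives the increasing numbering; both sums are invariant under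
    permutation. *)
Lemma gcd_system_realize (R : realType) (N : nat) (s : seq (nat * R)) (rho : R) :
  uniq (map fst s) -> (forall a, a \in s -> (0 < a.1)%N /\ 0 < a.2) ->
  size s = N -> sq_weight s * rho <= gcd_form s s ->
  exists (n : 'I_N -> nat) (c : 'I_N -> R),
      (forall k : 'I_N, (1 <= n k)%N) /\
      (forall k l : 'I_N, (k < l)%N -> (n k < n l)%N) /\
      (forall k : 'I_N, 0 < c k) /\
      (\sum_(j < N) c j ^+ 2) * rho
      <= \sum_(k < N) \sum_(l < N)
           c k * c l * ((gcdn (n k) (n l))%:R / Num.sqrt (n k * n l)%:R).
Proof.
move=> us sp sN H.
pose t := sort (relpre fst leq) s.
have pt : perm_eq t s by rewrite perm_sort.
have tN : size t = N by rewrite size_sort.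
have lt_t : sorted ltn (map fst t).
  rewrite ltn_sorted_uniq_leq (perm_uniq (perm_map _ pt)) us /=.
  rewrite sorted_map; apply: sort_sorted => a b; exact: leq_total.
have tp a : a \in t -> (0 < a.1)%N /\ 0 < a.2 by rewrite (perm_mem pt); apply: sp.
pose x (k : 'I_N) := nth (0%N, 0) t k.
have xt k : x k \in t by rewrite mem_nth // tN.
have sumE (F : nat * R -> R) : \sum_(k < N) F (x k) = \sum_(a <- s) F a.
  by rewrite -(perm_big _ pt) /= (big_nth (0%N, 0)) tN big_mkord.
exists (fun k => (x k).1), (fun k => (x k).2); split; first by move=> k; case: (tp _ (xt k)).
split.
  move=> k l kl; rewrite -!(nth_map (0%N, 0) 0%N fst) ?tN //.
  by apply: (sorted_ltn_nth ltn_trans 0%N lt_t) => //; rewrite inE size_map tN.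
split; first by move=> k; case: (tp _ (xt k)).
rewrite (sumE (fun a => a.2 ^+ 2)); apply: le_trans H _.
rewrite /gcd_form -sumE; apply: ler_sum => k _.
by rewrite -(sumE (fun b => (x k).2 * b.2 * gcd_kernel R (x k).1 b.1)).
Qed.

(** * Cutting the primes into sets of prescribed mass *)

(** Elements are taken until the sum reaches [eta]; the last one overshoots by at most [d]. *)
Lemma greedy_prefix (R : realType) (w : nat -> R) (d eta : R) (A : seq nat) :
  0 <= d -> (forall p, p \in A -> w p <= d) -> 0 <= eta ->
  eta <= \sum_(p <- A) w p ->
  exists Q A', A = Q ++ A' /\ eta <= \sum_(p <- Q) w p <= eta + d.
Proof.
move=> d0; elim: A eta => [|a A IH] eta wd e0.
  rewrite big_nil => e1; exists [::], [::]; split => //.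
  by rewrite big_nil e1 /= addr_ge0.
rewrite big_cons => eS; have wa : w a <= d by rewrite wd // mem_head.
case: (leP eta (w a)) => [ea|ae].
  by exists [:: a], A; split => //; rewrite big_seq1 ea /= ler_wpDl.
have [|||Q [A' [-> /andP[Q1 Q2]]]] := IH (eta - w a).
- by move=> p pA; rewrite wd // inE pA orbT.
- by rewrite subr_ge0 ltW.
- by rewrite lerBlDl.
exists (a :: Q), A'; split => //; rewrite big_cons; apply/andP; split; lra.
Qed.

Lemma greedy_split (R : realType) (w : nat -> R) (d eta : R) (t : nat) (A : seq nat) :
  0 <= d -> (forall p, p \in A -> w p <= d) -> 0 <= eta ->
  t%:R * (eta + d) <= \sum_(p <- A) w p ->
  exists Qs A', [/\ A = flatten Qs ++ A', size Qs = t &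
    all (fun Q => eta <= \sum_(p <- Q) w p <= eta + d) Qs].
Proof.
move=> d0 + e0; elim: t A => [|t IH] A wd H; first by exists [::], A.
have te : 0 <= t%:R * (eta + d) by rewrite mulr_ge0 // addr_ge0.
have [|Q [A' [E Qe]]] := @greedy_prefix R w d eta A d0 wd e0.
  by apply: le_trans H; rewrite -nat1r mulrDl; lra.
have [||Qs [A'' [E' sz al]]] := IH A'.
- by move=> p pA; rewrite wd // E mem_cat pA orbT.
- move: H Qe; rewrite E big_cat /= -nat1r mulrDl => H /andP[_ Q2]; lra.
exists (Q :: Qs), A''; split => //=; first by rewrite -catA -E'.
  by rewrite sz.
by rewrite Qe.
Qed.

(** Greedy cutting with [w p = 1 / p] and [d = 1 / x]. Each prime is at most [B * x], so a bound on
    the mass of a set bounds its size. *)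
Lemma prime_block (R : realType) (B x r : nat) (eta : R) :
  (1 < B)%N -> (0 < x)%N -> 0 < eta ->
  r%:R * (eta + x%:R^-1) <= (ln B%:R - 7) / ln (B * x)%:R ->
  exists Qs : seq (seq nat),
    [/\ uniq (flatten Qs), all prime (flatten Qs),
        all (fun p => x < p <= B * x)%N (flatten Qs), size Qs = r &
        all (fun Q => (eta <= \sum_(p <- Q) p%:R^-1) &&
                      ((size Q)%:R <= (eta + x%:R^-1) * (B * x)%:R)) Qs].
Proof.
move=> B1 x0 e0 H.
have Bx : (1 < B * x)%N by nia.
have xBx : (x <= B * x)%N by nia.
have B0 : (0 < B)%N by lia.
have x0' : 0 < x%:R :> R by rewrite ltr0n.
pose A := [seq p <- index_iota x.+1 (B * x).+1 | prime p].
have AE p : (p \in A) = prime p && (x < p <= B * x)%N.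
  by rewrite mem_filter mem_index_iota ltnS.
have [||||Qs [A' [E sz al]]] := @greedy_split R (fun p => p%:R^-1) x%:R^-1 eta r A.
- by rewrite invr_ge0.
- move=> p; rewrite AE => /andP[_ /andP[xp _]].
  by rewrite lef_pV2 ?posrE ?ltr0n ?ler_nat ?(ltnW xp) // (leq_ltn_trans _ xp).
- exact: ltW.
- apply: le_trans H _; rewrite big_filter.
  have := @sum_inv_primes_ge R x (B * x) x0 xBx Bx.
  suff -> : ln (B * x)%:R - ln x%:R = ln B%:R :> R by [].
  by rewrite natrM lnM ?posrE ?ltr0n // addrK.
have uA : uniq A by rewrite filter_uniq // iota_uniq.
have sub p : p \in flatten Qs -> p \in A by rewrite E mem_cat => ->.
exists Qs; split => //.
- by move: uA; rewrite E cat_uniq => /andP[].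
- by apply/allP => p /sub; rewrite AE => /andP[].
- by apply/allP => p /sub; rewrite AE => /andP[].
apply/allP => Q QQs; have /andP[-> Q2] /= := allP al _ QQs.
rewrite -ler_pdivrMr ?ltr0n ?(ltnW Bx) //; apply: le_trans Q2.
rewrite mulr_natl -iter_addr_0 -(count_predT Q) -big_const_seq big_seq [leRHS]big_seq.
apply: ler_sum => p pQ; have : p \in A by apply: sub; apply/flattenP; exists Q.
rewrite AE => /andP[pp /andP[_ pBx]].
have p0 := prime_gt0 pp; have Bx0 := ltnW Bx.
by rewrite lef_pV2 ?posrE ?ltr0n ?ler_nat.
Qed.

Lemma prime_blocks (R : realType) (B X K : nat) (r : nat -> nat) (eta : nat -> R) :
  (1 < B)%N -> (0 < X)%N ->
  (forall k, (1 <= k <= K)%N -> 0 < eta k /\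
    (r k)%:R * (eta k + (B ^ k * X)%:R^-1) <=
      (ln B%:R - 7) / ln (B ^ k.+1 * X)%:R) ->
  exists Qs : seq (seq nat),
    [/\ uniq (flatten Qs), all prime (flatten Qs),
        all (fun Q => 0 < \sum_(p <- Q) p%:R^-1 :> R) Qs,
        (\prod_(Q <- Qs) (size Q).+1)%:R <= \prod_(1 <= k < K.+1)
          (1 + (eta k + (B ^ k * X)%:R^-1) * (B ^ k.+1 * X)%:R) ^+ r k &
        \prod_(1 <= k < K.+1) (1 + Num.sqrt (eta k)) ^+ r k <=
        \prod_(Q <- Qs) (1 + Num.sqrt (\sum_(p <- Q) p%:R^-1))].
Proof.
move=> B1 X0 H.
(* The induction also carries an upper bound on the primes used, which makes the next block disjoint
   from them. *)
suff [Qs [h1 h2 _ h3 [h4 h5]]] : exists Qs : seq (seq nat),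
    [/\ uniq (flatten Qs), all prime (flatten Qs),
        all (fun p => p <= B ^ K.+1 * X)%N (flatten Qs),
        all (fun Q => 0 < \sum_(p <- Q) p%:R^-1 :> R) Qs &
        (\prod_(Q <- Qs) (size Q).+1)%:R <= \prod_(1 <= k < K.+1)
          (1 + (eta k + (B ^ k * X)%:R^-1) * (B ^ k.+1 * X)%:R) ^+ r k /\
        \prod_(1 <= k < K.+1) (1 + Num.sqrt (eta k)) ^+ r k <=
        \prod_(Q <- Qs) (1 + Num.sqrt (\sum_(p <- Q) p%:R^-1))].
  by exists Qs.
elim: K H => [|K IH] H; first by exists [::]; split; rewrite ?big_nil ?big_geq //.
have [|Qs [u1 p1 b1 s1 [z1 g1]]] := IH.
  by move=> k /andP[k1 kK]; apply: H; rewrite k1 leqW.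
have kK : (1 <= K.+1 <= K.+1)%N by rewrite leqnn.
have [e0 He] := H _ kK.
have x0 : (0 < B ^ K.+1 * X)%N by rewrite muln_gt0 expn_gt0 X0 (ltnW B1).
have EB : (B ^ K.+2 * X = B * (B ^ K.+1 * X))%N by rewrite expnS mulnA.
have [|Q' [u2 p2 b2 sz a2]] := @prime_block R B _ (r K.+1) (eta K.+1) B1 x0 e0.
  by rewrite -EB.
exists (Qs ++ Q'); rewrite flatten_cat !all_cat p1 p2 s1 /=; split => //.
- rewrite cat_uniq u1 u2 andbT /=; apply/hasPn => p /(allP b2) /andP[lp _].
  by apply/negP => /(allP b1); rewrite leqNgt lp.
- apply/andP; split; apply/allP => p.
    move=> /(allP b1) /leq_trans; apply; rewrite EB.
    by rewrite leq_pmull // ltnW.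
  by move=> /(allP b2) /andP[_]; rewrite EB.
- by apply/allP => Q /(allP a2) /andP[/(lt_le_trans e0)].
split.
  rewrite big_cat big_nat_recr //= natrM; apply: ler_pM => //.
  rewrite natr_prod -sz -iter_mulr_1 -(count_predT Q') -big_const_seq.
  rewrite [leLHS]big_seq [leRHS]big_seq; apply: ler_prod => Q /(allP a2) /andP[_].
  by rewrite -EB ler0n -nat1r lerD2l.
rewrite big_cat big_nat_recr //=; apply: ler_pM => //.
  by apply: prodr_ge0 => k _; rewrite exprn_ge0 // addr_ge0 ?sqrtr_ge0.
  rewrite -sz -iter_mulr_1 -(count_predT Q') -big_const_seq.
  rewrite [leLHS]big_seq [leRHS]big_seq; apply: ler_prod => Q /(allP a2) /andP[eQ _].
  by rewrite lerD2l ler_wsqrtr // addr_ge0 ?sqrtr_ge0.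
Qed.

(** * Harmonic and inverse square sums *)

Lemma harmonic_ge (R : realType) (n : nat) :
  ln n.+1%:R <= \sum_(1 <= k < n.+1) k%:R^-1 :> R.
Proof.
elim: n => [|n IH]; first by rewrite big_geq // ln1.
rewrite big_nat_recr //=.
have n0 : 0 < n.+1%:R :> R by rewrite ltr0n.
have i0 : 0 < n.+1%:R^-1 :> R by rewrite invr_gt0.
have -> : n.+2%:R = n.+1%:R * (1 + n.+1%:R^-1) :> R.
  by rewrite mulrDr mulr1 divff ?lt0r_neq0 // natr1.
rewrite lnM ?posrE ?addr_gt0 //; apply: lerD IH _.
by apply: le_ln1Dx; apply: lt_trans i0; rewrite oppr_lt0.
Qed.

Lemma harmonic_le (R : realType) (n : nat) : (0 < n)%N ->
  \sum_(1 <= k < n.+1) k%:R^-1 <= 1 + ln n%:R :> R.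
Proof.
case: n => // n _; elim: n => [|n IH]; first by rewrite big_nat1 ln1 invr1 addr0.
rewrite big_nat_recr //=; apply: le_trans (lerD IH (lexx _)) _.
have n0 : 0 < n.+2%:R :> R by rewrite ltr0n.
have m0 : 0 < n.+1%:R :> R by rewrite ltr0n.
have E : n.+1%:R = n.+2%:R * (1 - n.+2%:R^-1) :> R.
  by rewrite mulrBr mulr1 divff ?lt0r_neq0 // -[n.+2%:R]natr1 addrK.
have i0 : 0 < 1 - n.+2%:R^-1 :> R by rewrite -(pmulr_rgt0 _ n0) -E.
have L : ln (1 - n.+2%:R^-1) <= - n.+2%:R^-1 :> R by apply: le_ln1Dx; rewrite ltrN2 -subr_gt0.
by rewrite E lnM ?posrE // -addrA lerD2l -addrA gerDl -lerBrDr sub0r.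
Qed.

Lemma sum_inv_squares_le (R : realType) (n : nat) :
  \sum_(1 <= k < n.+1) (k%:R ^+ 2)^-1 <= 2 :> R.
Proof.
case: n => [|n]; first by rewrite big_geq.
(* The sharper bound [2 - 1 / n] is the one that passes through the induction. *)
apply: (@le_trans _ _ (2 - n.+1%:R^-1)); last by rewrite gerBl invr_ge0.
elim: n => [|n IH]; first by rewrite big_nat1 expr1n invr1; lra.
rewrite big_nat_recr //=; apply: le_trans (lerD IH (lexx _)) _.
rewrite -[n.+2%:R]nat1r; have : 0 < n.+1%:R :> R by rewrite ltr0n.
move: (n.+1%:R : R) => x x0.
have -> : 2 - x^-1 + ((1 + x) ^+ 2)^-1 = 2 - (1 + x)^-1 - (x * (1 + x) ^+ 2)^-1.
  by field; rewrite !lt0r_neq0 //; lra.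
by rewrite gerBl invr_ge0 mulr_ge0 ?exprn_ge0 ?addr_ge0 ?(ltW x0).
Qed.

(** * Choice of the parameters *)

(** [ln (1 + y)] is at least [y / (1 + y)], and the hypothesis says that [g] is at most
    [1 / (1 + y)]. *)
Lemma ln1D_ge (R : realType) (g y : R) : 0 <= y -> g * (1 + y) <= 1 -> g * y <= ln (1 + y).
Proof.
move=> y0 gy; have y1 : 0 < 1 + y by rewrite ltr_wpDr.
have i0 : 0 < (1 + y)^-1 by rewrite invr_gt0.
have H : ln ((1 + y)^-1) <= (1 + y)^-1 - 1.
  rewrite [X in ln X](_ : _ = 1 + ((1 + y)^-1 - 1)); last by rewrite addrCA subrr addr0.
  by apply: le_ln1Dx; lra.
have gi : g <= (1 + y)^-1 by rewrite -[leRHS]mul1r ler_pdivlMr.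
have E : (1 + y)^-1 - 1 = - (y * (1 + y)^-1) by field; rewrite lt0r_neq0.
rewrite lnV ?posrE // E lerN2 in H; apply: le_trans H.
by rewrite mulrC ler_wpM2l.
Qed.

Lemma expR_ge_pow (R : realType) (n : nat) (x : R) : 0 <= x ->
  x ^+ n.+1 / (n.+1)`!%:R <= expR x.
Proof. by move=> x0; apply: le_trans (expR_ge1Dxn n x0); rewrite lerDr. Qed.

(** Verifies the mass condition of [prime_blocks]. The demand is at most [(g ^ 2 c + 1 / c) / l],
    because the [k ^ 2] in [eta] cancels the one in [r]; the supply is at least [g (c - 9) / l],
    where [c - 9 = ln B - 7]. *)
Lemma block_mass (R : realType) (g c l lam L : R) (B X k r : nat) :
  0 < g -> 0 < c -> 0 < l -> 0 < lam -> 0 < L -> (1 < B)%N -> ln B%:R = c - 2 ->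
  (0 < k)%N -> L * l / lam <= X%:R -> r%:R <= L / (c * k%:R ^+ 2 * lam) ->
  ln (B ^ k.+1 * X)%:R <= l / g -> g ^+ 2 * c + c^-1 <= g * (c - 9) ->
  r%:R * ((g * c * k%:R) ^+ 2 * (lam / (L * l)) + (B ^ k * X)%:R^-1) <=
    (ln B%:R - 7) / ln (B ^ k.+1 * X)%:R.
Proof.
move=> g0 c0 l0 lam0 L0 B1 lB k0 HX Hr HlX Hc.
have k1 : 1 <= k%:R :> R by rewrite ler1n.
have k0' : 0 < k%:R :> R by rewrite ltr0n.
have Ll0 : 0 < L * l / lam by rewrite divr_gt0 // mulr_gt0.
have X0 : 0 < X%:R :> R by apply: lt_le_trans HX.
have lX0 : 0 < ln (B ^ k.+1 * X)%:R :> R.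
  rewrite ln_gt0 // ltr1n; move: X0; rewrite ltr0n => X0.
  apply: leq_trans (leq_pmulr _ X0); apply: (leq_trans B1).
  by rewrite expnS leq_pmulr // expn_gt0 (ltnW B1).
have Hx : (B ^ k * X)%:R^-1 <= lam / (L * l) :> R.
  rewrite -invf_div lef_pV2 ?posrE ?ltr0n //; last first.
    by move: X0; rewrite ltr0n muln_gt0 expn_gt0 => ->; rewrite (ltnW B1).
  apply: le_trans HX _; by rewrite ler_nat leq_pmull // expn_gt0 (ltnW B1).
have u0 : 0 < lam / (L * l) by rewrite divr_gt0 // mulr_gt0.
apply: (@le_trans _ _ (L / (c * k%:R ^+ 2 * lam) *
   ((g * c * k%:R) ^+ 2 * (lam / (L * l)) + lam / (L * l)))).
  apply: ler_pM => //; last by rewrite lerD2l.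
  by rewrite addr_ge0 ?invr_ge0 // mulr_ge0 ?sqr_ge0 // ltW.
have -> : L / (c * k%:R ^+ 2 * lam) *
   ((g * c * k%:R) ^+ 2 * (lam / (L * l)) + lam / (L * l)) =
   (g ^+ 2 * c + c^-1 * (k%:R ^+ 2)^-1) / l.
  by field; rewrite !lt0r_neq0.
apply: (@le_trans _ _ (g * (c - 9) / l)).
  rewrite ler_pM2r ?invr_gt0 //; apply: le_trans Hc; rewrite lerD2l.
  by rewrite ler_piMr ?invr_ge0 ?(ltW c0) // invf_le1 ?exprn_gt0 // exprn_ege1.
rewrite lB ler_pdivlMr //.
have -> : c - 2 - 7 = c - 9 by lra.
have c9 : 0 <= c - 9.
  rewrite -(pmulr_rge0 _ g0); apply: le_trans Hc.
  by rewrite addr_ge0 ?invr_ge0 ?mulr_ge0 ?sqr_ge0 // ltW.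
have E : g * (c - 9) / l * (l / g) = c - 9 by field; rewrite !lt0r_neq0.
by rewrite -[leRHS]E ler_wpM2l // divr_ge0 ?mulr_ge0 // ltW.
Qed.

(** The choice of [X] leaves a constant times [k ^ 2 * B ^ k]. Here [B ^ k = exp (k (c - 2))] and
    [k ^ 2 <= exp (2 k)], which explains [c = ln B + 2]. *)
Lemma block_size (R : realType) (g c l lam L : R) (B X k : nat) :
  0 < g < 1 -> 0 < c -> 0 < l -> 0 < lam -> 0 < L -> (1 < B)%N -> ln B%:R = c - 2 ->
  (0 < k)%N -> (0 < X)%N -> X%:R <= 2 * (L * l / lam) ->
  1 + ((g * c * k%:R) ^+ 2 * (lam / (L * l)) + (B ^ k * X)%:R^-1) * (B ^ k.+1 * X)%:R
   <= expR (ln ((2 * c ^+ 2 + 2) * B%:R) + k%:R * c).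
Proof.
move=> /andP[g0 g1] c0 l0 lam0 L0 B1 lB k0 X0 HX.
have k1 : 1 <= k%:R :> R by rewrite ler1n.
have k0' : 0 < k%:R :> R by rewrite ltr0n.
have B0' : 0 < B%:R :> R by rewrite ltr0n ltnW.
have B1' : 1 <= B%:R :> R by rewrite ler1n ltnW.
have X0' : 0 < X%:R :> R by rewrite ltr0n.
have u0 : 0 < lam / (L * l) by rewrite divr_gt0 // mulr_gt0.
have Bk1 : 1 <= B%:R ^+ k :> R by rewrite exprn_ege1.
have E1 : ((g * c * k%:R) ^+ 2 * (lam / (L * l)) + (B ^ k * X)%:R^-1) * (B ^ k.+1 * X)%:R
  = g ^+ 2 * (c ^+ 2 * k%:R ^+ 2 * B%:R * B%:R ^+ k * ((lam / (L * l)) * X%:R)) + B%:R.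
  rewrite !natrM !natrX [B%:R ^+ k.+1]exprS; have : B%:R ^+ k != 0 :> R by rewrite lt0r_neq0 // exprn_gt0.
  by move: (B%:R ^+ k : R) => y y0; field; rewrite y0 !lt0r_neq0.
have HX' : lam / (L * l) * X%:R <= 2.
  apply: le_trans (ler_wpM2l (ltW u0) HX) _.
  by rewrite le_eqVlt; apply/orP; left; apply/eqP; field; rewrite !lt0r_neq0.
set P := c ^+ 2 * k%:R ^+ 2 * B%:R * B%:R ^+ k.
have P0 : 0 <= P by rewrite !mulr_ge0 ?exprn_ge0 // ltW.
have g2 : g ^+ 2 <= 1 by rewrite expr_le1 // ltW.
have E2 : g ^+ 2 * (P * (lam / (L * l) * X%:R)) <= 2 * P.
  apply: (@le_trans _ _ (1 * (P * 2))); last by rewrite mul1r mulrC.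
  apply: ler_pM => //; first exact: sqr_ge0.
    by apply: mulr_ge0 => //; apply: mulr_ge0 => //; apply: ltW.
  exact: ler_wpM2l.
have k2 : 1 <= k%:R ^+ 2 :> R by rewrite exprn_ege1.
have E3 : 1 + B%:R <= 2 * (k%:R ^+ 2 * B%:R * B%:R ^+ k) :> R.
  have : B%:R * 1 <= B%:R * (k%:R ^+ 2 * B%:R ^+ k) :> R.
    rewrite ler_pM2l // -[leLHS]mulr1; apply: ler_pM => //.
  have -> : k%:R ^+ 2 * B%:R * B%:R ^+ k = B%:R * (k%:R ^+ 2 * B%:R ^+ k) :> R by ring.
  by move: (k%:R ^+ 2 * _) => z; lra.
rewrite E1 -/P; apply: (@le_trans _ _ ((2 * c ^+ 2 + 2) * B%:R * (k%:R ^+ 2 * B%:R ^+ k))).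
  apply: (@le_trans _ _ (2 * P + 2 * (k%:R ^+ 2 * B%:R * B%:R ^+ k))); first lra.
  by rewrite /P le_eqVlt; apply/orP; left; apply/eqP; ring.
have C0 : 0 < (2 * c ^+ 2 + 2) * B%:R by rewrite mulr_gt0 // addr_gt0 // mulr_gt0 // exprn_gt0.
rewrite expRD lnK ?posrE // ler_pM2l //.
have -> : k%:R * c = k%:R * 2 + k%:R * ln B%:R by rewrite lB; ring.
rewrite expRD; apply: ler_pM; first exact: exprn_ge0.
- exact: exprn_ge0.
- rewrite mulrC expRM_natl ler_pXn2r ?nnegrE ?(ltW k0') // ?expR_ge0 //.
  by apply: le_trans (expR_ge1Dx _); rewrite lerDr.
- by rewrite expRM_natl lnK.
Qed.

(** The four factors [g] are the prices of rounding [r], of the [g] inside [sqrt eta], of replacing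
    [ln (1 + sqrt eta)] by [g * sqrt eta], and of stopping at [k <= l ^ g]. The last four hypotheses
    control, in order, the number of integers, the logarithm of the largest primes, the rounding of
    [r], and the size of [eta]. *)
Lemma chunks_core (R : realType) (g lam c : R) (B : nat) :
  0 < g < 1 -> 2 <= lam -> (1 < B)%N -> ln B%:R = c - 2 -> 2 < c ->
  g ^+ 2 * c + c^-1 <= g * (c - 9) ->
  1 + 2 * (ln ((2 * c ^+ 2 + 2) * B%:R) / c) <= (1 - g) * lam ->
  2 * (c - 2) + g^-1 <= (g^-1 - 1) * ((1 - g) * lam) ->
  24 * c <= (1 - g) * lam ->
  24 * c ^+ 2 <= (g^-1 - 1) ^+ 2 * lam ->
  exists Qs : seq (seq nat),
    [/\ uniq (flatten Qs), all prime (flatten Qs),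
        all (fun Q => 0 < \sum_(p <- Q) p%:R^-1 :> R) Qs,
        (\prod_(Q <- Qs) (size Q).+1)%:R <= expR (expR (expR lam)) &
        expR (g ^+ 4 * Num.sqrt (expR (expR lam) * lam / expR lam)) <=
        \prod_(Q <- Qs) (1 + Num.sqrt (\sum_(p <- Q) p%:R^-1))].
Proof.
move=> g01 lam2 B1 lB c2 Hc H1 H2 H3 H4; have /andP[g0 g1] := g01.
set D := ln ((2 * c ^+ 2 + 2) * B%:R) in H1.
set l := expR lam; set L := expR l.
have lam0 : 0 < lam by lra.
have c0 : 0 < c by lra.
have l0 : 0 < l by apply: expR_gt0.
have L0 : 0 < L by apply: expR_gt0.
have laml : lam <= l by apply: le_trans (expR_ge1Dx lam); rewrite lerDr.
have l1 : 1 <= l by lra.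
have lL : l <= L by apply: le_trans (expR_ge1Dx l); rewrite lerDr.
(* This one term of the exponential series outgrows every power of [l] met below. *)
have L4 : l ^+ 4 / 24 <= L by have := @expR_ge_pow R 3 l (ltW l0).
have D0 : 0 <= D.
  rewrite ln_ge0 // -[leLHS]mulr1; apply: ler_pM => //; last by rewrite ler1n ltnW.
  by apply: (@le_trans _ _ 2); rewrite ?ler1n // lerDr mulr_ge0 // exprn_ge0 // ltW.
pose X := (Num.truncn (L * l / lam)).+1.
have Ll1 : 1 <= L * l / lam by rewrite ler_pdivlMr // mul1r (le_trans laml) // ler_peMl //; lra.
have X1 : L * l / lam <= X%:R by apply/ltW/truncnS_gt.
have X2 : X%:R <= 2 * (L * l / lam).
  have : (Num.truncn (L * l / lam))%:R <= L * l / lam by rewrite truncn_le; lra.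
  by rewrite /X -nat1r; lra.
(* [E] is [l ^ g]: small enough that [B ^ K] hardly affects the logarithm of the primes, yet with
   [ln E = g * lam]. *)
pose E := expR (g * lam); pose K := Num.truncn E.
have E1 : 1 + g * lam <= E by apply: expR_ge1Dx.
have glam : 0 < g * lam by rewrite mulr_gt0.
have K1 : (0 < K)%N by rewrite truncn_gt0; lra.
have KE : K%:R <= E by rewrite truncn_le expR_ge0.
have EK : E < K.+1%:R by apply: truncnS_gt.
have El : E <= l by rewrite ler_expR ler_piMl ?(ltW lam0) // ltW.
pose r (k : nat) := Num.truncn (L / (c * k%:R ^+ 2 * lam)).
pose eta (k : nat) := (g * c * k%:R) ^+ 2 * (lam / (L * l)).
have gi : 0 < g^-1 - 1 by rewrite subr_gt0 invf_gt1.
have HEl : E * (2 * (c - 2) + g^-1) <= (g^-1 - 1) * l.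
  have -> : l = E * expR ((1 - g) * lam).
    by rewrite /l /E -expRD -mulrDl addrC subrK mul1r.
  rewrite [leRHS]mulrCA ler_pM2l ?expR_gt0 //; apply: le_trans H2 _.
  by rewrite ler_pM2l //; apply: le_trans (expR_ge1Dx _); rewrite lerDr.
have kfacts k : (1 <= k <= K)%N -> [/\ 1 <= k%:R :> R, k%:R <= E :> R & k%:R <= l :> R].
  move=> /andP[k1 kK]; have kE : k%:R <= E by apply: le_trans KE; rewrite ler_nat.
  by split; rewrite ?ler1n // (le_trans kE).
have r_le k : (r k)%:R <= L / (c * k%:R ^+ 2 * lam).
  by rewrite truncn_le divr_ge0 ?mulr_ge0 ?exprn_ge0 // ltW.
have c4 : l ^+ 3 * (24 * c) <= (1 - g) * (24 * L).
  apply: (@le_trans _ _ ((1 - g) * l ^+ 4)).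
    rewrite (exprSr l 3) [leRHS]mulrCA ler_pM2l ?exprn_gt0 //; apply: le_trans H3 _.
    by rewrite ler_pM2l // subr_gt0.
  by rewrite ler_pM2l ?subr_gt0 //; move: L4; lra.
have r_ge k : (1 <= k <= K)%N -> g * (L / (c * k%:R ^+ 2 * lam)) <= (r k)%:R.
  move=> /kfacts[k1 _ kl].
  have k0 : 0 < k%:R :> R by lra.
  set z := L / _.
  have : z < (r k)%:R + 1 by rewrite natr1; apply: truncnS_gt.
  (* Truncation loses less than 1, which is at most the fraction [1 - g] of [z]. *)
  suff : 1 <= (1 - g) * z by lra.
  have m0 : 0 < c * k%:R ^+ 2 * lam by rewrite !mulr_gt0.
  rewrite /z mulrA ler_pdivlMr // mul1r.
  have : k%:R ^+ 2 * lam <= l ^+ 3.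
    rewrite (exprSr l 2); apply: ler_pM => //; rewrite ?exprn_ge0 ?(ltW lam0) //.
    by rewrite ler_pXn2r ?nnegrE ?(ltW k0) ?(ltW l0).
  move=> /(ler_wpM2l (ltW c0)); rewrite mulrA => /le_trans; apply.
  by move: c4; lra.
have eta_le k : (1 <= k <= K)%N -> Num.sqrt (eta k) <= g^-1 - 1.
  move=> /kfacts[k1 _ kl].
  rewrite -[leRHS]ger0_norm ?(ltW gi) // -sqrtr_sqr ler_wsqrtr //.
  rewrite /eta mulrA ler_pdivrMr ?mulr_gt0 //.
  apply: (@le_trans _ _ (c ^+ 2 * l ^+ 2 * l)).
    have k0 : 0 < k%:R :> R by lra.
    apply: ler_pM => //; rewrite ?sqr_ge0 ?(ltW lam0) //.
    rewrite -exprMn ler_pXn2r ?nnegrE ?mulr_ge0 ?(ltW k0) ?(ltW c0) ?(ltW g0) ?(ltW l0) //.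
    apply: ler_pM => //; rewrite ?mulr_ge0 ?(ltW k0) ?(ltW c0) ?(ltW g0) //.
    by rewrite ger_pMl // ltW.
  rewrite [leRHS]mulrA ler_pM2r //.
  have H4' : 24 * c ^+ 2 <= (g^-1 - 1) ^+ 2 * l.
    by apply: le_trans H4 _; rewrite ler_pM2l // exprn_gt0.
  have : l ^+ 3 <= 24 * L.
    apply: (@le_trans _ _ (l ^+ 4)); last by move: L4; lra.
    by rewrite (exprS l 3) ler_peMl // exprn_ge0 // ltW.
  move=> /(ler_wpM2l (sqr_ge0 (g^-1 - 1))).
  have /(ler_wpM2r (sqr_ge0 l)) := H4'.
  rewrite (exprS l 2); move: ((g^-1 - 1) ^+ 2) => q; rewrite !mulrA; lra.
have eta0 k : (1 <= k <= K)%N -> 0 < eta k.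
  move=> /kfacts[k1 _ _]; have k0 : 0 < k%:R :> R by lra.
  by apply: mulr_gt0; [rewrite exprn_gt0 // !mulr_gt0|rewrite divr_gt0 // mulr_gt0].
have [|Qs [q1 q2 q3 q4 q5]] := @prime_blocks R B X K r eta B1 isT.
  move=> k kK; have [k1 kE _] := kfacts k kK; split; first exact: eta0.
  have kn0 : (0 < k)%N by case/andP: kK.
  apply: (@block_mass R g c l lam L) => //.
  have X0 : 0 < X%:R :> R by rewrite ltr0n.
  have B0 : 0 < B%:R :> R by rewrite ltr0n ltnW.
  rewrite natrM natrX lnM ?posrE ?exprn_gt0 // lnXn // lB -[_ *+ k.+1]mulr_natl.
  (* [2 <= lam] absorbs the factor 2 in the upper bound for [X]. *)
  have lX : ln X%:R <= l + lam.
    have -> : l + lam = ln (L * l) by rewrite lnM ?posrE // !expRK.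
    rewrite ler_ln ?posrE ?mulr_gt0 //; apply: le_trans X2 _.
    rewrite mulrA ler_pdivrMr // mulrC ler_pM2l ?mulr_gt0 //.
  have : k.+1%:R * (c - 2) <= 2 * E * (c - 2).
    by rewrite ler_pM2r ?subr_gt0 // -nat1r; lra.
  have : lam <= E / g by rewrite ler_pdivlMr // mulrC; lra.
  have : 2 * E * (c - 2) + E / g <= l / g - l.
    have -> : 2 * E * (c - 2) + E / g = E * (2 * (c - 2) + g^-1) by ring.
    by have -> : l / g - l = (g^-1 - 1) * l by ring.
  by move: (2 * E * _) (k.+1%:R * _) (ln X%:R) (E / g) (l / g) lX => *; lra.
exists Qs; split => //.
- apply: le_trans q4 _.
  apply: (@le_trans _ _ (\prod_(1 <= k < K.+1) expR ((r k)%:R * (D + k%:R * c)))).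
    rewrite big_nat [leRHS]big_nat; apply: ler_prod => k kK.
    have kn0 : (0 < k)%N by case/andP: kK.
    have e0 := eta0 k kK.
    have p0 : 0 <= 1 + (eta k + (B ^ k * X)%:R^-1) * (B ^ k.+1 * X)%:R.
      by rewrite addr_ge0 // mulr_ge0 // addr_ge0 ?invr_ge0 // ltW.
    rewrite exprn_ge0 //= expRM_natl; apply: lerXn2r; rewrite ?nnegrE ?expR_ge0 //.
    exact: block_size.
  rewrite -expR_sum ler_expR.
  (* The sum is at most [(L / lam) * (2 D / c + 1 + g * lam)], which [H1] bounds by [L]. *)
  apply: (@le_trans _ _ (\sum_(1 <= k < K.+1) L / lam * (D / c * (k%:R ^+ 2)^-1 + k%:R^-1))).
    rewrite big_nat [leRHS]big_nat; apply: ler_sum => k kK.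
    have [k1 _ _] := kfacts k kK; have k0 : 0 < k%:R :> R by lra.
    apply: le_trans (ler_wpM2r _ (r_le k)) _.
      by rewrite addr_ge0 // mulr_ge0 // ltW.
    by rewrite le_eqVlt; apply/orP; left; apply/eqP; field; rewrite !lt0r_neq0.
  rewrite -mulr_sumr mulrAC ler_pdivrMr // ler_pM2l //.
  rewrite big_split /= -mulr_sumr.
  have : D / c * \sum_(1 <= k < K.+1) (k%:R ^+ 2)^-1 <= D / c * 2.
    by apply: ler_wpM2l (sum_inv_squares_le R K); rewrite divr_ge0 // ltW.
  have := harmonic_le R K K1.
  have : ln K%:R <= g * lam by rewrite -ler_expR lnK // posrE ltr0n.
  by move: (\sum_(_ <= _ < _) _^-1) (_ * \sum_(_ <= _ < _) _) (ln _) H1 => s t u; lra.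
- apply: le_trans q5.
  pose u := Num.sqrt (lam / (L * l)).
  have u0 : 0 <= u by apply: sqrtr_ge0.
  have -> : Num.sqrt (L * lam / l) = L * u.
    have -> : L * lam / l = L ^+ 2 * (lam / (L * l)) by field; rewrite !lt0r_neq0.
    by rewrite sqrtrM ?sqr_ge0 // sqrtr_sqr ger0_norm // ltW.
  apply: (@le_trans _ _ (\prod_(1 <= k < K.+1) expR ((r k)%:R * (g * Num.sqrt (eta k))))).
    rewrite -expR_sum ler_expR.
    (* [r k] decays like [1 / k ^ 2] and [sqrt (eta k)] grows like [k], so the products form a
       harmonic sum, of size at least [g * lam]. *)
    apply: (@le_trans _ _ (\sum_(1 <= k < K.+1) g ^+ 3 * (L * u) / lam * k%:R^-1)).
      rewrite -mulr_sumr.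
      have H5 : g * lam <= \sum_(1 <= k < K.+1) k%:R^-1.
        apply: le_trans (harmonic_ge R K).
        by rewrite -ler_expR lnK ?posrE ?ltr0n // ltW.
      have -> : g ^+ 4 * (L * u) = g ^+ 3 * (L * u) / lam * (g * lam).
        by field; rewrite lt0r_neq0.
      by apply: ler_wpM2l H5; rewrite divr_ge0 ?mulr_ge0 ?exprn_ge0 // ltW.
    rewrite big_nat [leRHS]big_nat; apply: ler_sum => k kK.
    have [k1 _ _] := kfacts k kK; have k0 : 0 < k%:R :> R by lra.
    have -> : Num.sqrt (eta k) = g * c * k%:R * u.
      rewrite sqrtrM ?sqr_ge0 // sqrtr_sqr ger0_norm // !mulr_ge0 // ltW //.
    apply: le_trans (ler_wpM2r _ (r_ge k kK)); last by rewrite !mulr_ge0 // ltW.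
    by rewrite le_eqVlt; apply/orP; left; apply/eqP; field; rewrite !lt0r_neq0.
  rewrite big_nat [leRHS]big_nat; apply: ler_prod => k kK.
  rewrite expR_ge0 /= expRM_natl; have s0 := sqrtr_ge0 (eta k).
  apply: lerXn2r; rewrite ?nnegrE ?expR_ge0 ?addr_ge0 //.
  have p0 : 0 < 1 + Num.sqrt (eta k) by rewrite ltr_wpDr.
  rewrite -[leRHS]lnK // ler_expR; apply: ln1D_ge => //.
  have := eta_le k kK; rewrite -(ler_pM2l g0) mulrBr divff ?lt0r_neq0 // mulrDr; lra.
Qed.

Lemma chunks_exist (R : realType) (g : R) : 0 < g < 1 ->
  exists lam0 : R, forall lam, lam0 <= lam ->
  exists Qs : seq (seq nat),
    [/\ uniq (flatten Qs), all prime (flatten Qs),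
        all (fun Q => 0 < \sum_(p <- Q) p%:R^-1 :> R) Qs,
        (\prod_(Q <- Qs) (size Q).+1)%:R <= expR (expR (expR lam)) &
        expR (g ^+ 4 * Num.sqrt (expR (expR lam) * lam / expR lam)) <=
        \prod_(Q <- Qs) (1 + Num.sqrt (\sum_(p <- Q) p%:R^-1))].
Proof.
move=> g01; have /andP[g0 g1] := g01.
have gg : 0 < g * (1 - g) by rewrite mulr_gt0 // subr_gt0.
have gi : 0 < g^-1 - 1 by rewrite subr_gt0 invf_gt1.
have g1' : 0 < 1 - g by rewrite subr_gt0.
(* Then [c * g * (1 - g) >= 10 >= 9 * g + 1 / c], which is the condition [Hc]. *)
pose c0 := 10 / (g * (1 - g)).
have c00 : 0 < c0 by rewrite divr_gt0.
pose B := (Num.truncn (expR c0)).+1; pose c : R := ln B%:R + 2.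
have BE : expR c0 < B%:R by apply: truncnS_gt.
have lB : c0 < ln B%:R by rewrite -ltr_expR lnK // posrE ltr0n.
have B1 : (1 < B)%N by rewrite -(ltr1n R); apply: lt_trans BE; rewrite expR_gt1.
have c2 : 2 < c by rewrite /c; lra.
have Hc : g ^+ 2 * c + c^-1 <= g * (c - 9).
  have : 10 <= c * (g * (1 - g)) by rewrite -ler_pdivrMr // -/c0 /c; lra.
  have : c^-1 <= 1 by rewrite invf_le1; lra.
  by move: (c^-1) => z; rewrite expr2; lra.
pose D := ln ((2 * c ^+ 2 + 2) * B%:R).
(* [B] and [c] depend on [g] alone, so each remaining condition is a lower bound on [lam]. *)
exists (Num.max (Num.max 2 ((1 + 2 * (D / c)) / (1 - g)))
  (Num.max ((2 * (c - 2) + g^-1) / ((g^-1 - 1) * (1 - g)))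
  (Num.max (24 * c / (1 - g)) (24 * c ^+ 2 / (g^-1 - 1) ^+ 2)))) => lam.
rewrite !ge_max => /andP[/andP[lam2 h1] /and3P[h2 h3 h4]].
apply: (@chunks_core R g lam c B) => //.
- by rewrite /c addrK.
- by rewrite [leRHS]mulrC -ler_pdivrMr.
- by rewrite mulrA [leRHS]mulrC -ler_pdivrMr // mulr_gt0.
- by rewrite [leRHS]mulrC -ler_pdivrMr.
- by rewrite [leRHS]mulrC -ler_pdivrMr // exprn_gt0.
Qed.

Theorem theorem2 (R : realType) (gamma : R) (hgamma0 : 0 < gamma)
    (hgamma1 : gamma < 1) :
  exists N0 : nat, forall N : nat, (N0 <= N)%N ->
    exists (n : 'I_N -> nat) (c : 'I_N -> R),
      (forall k : 'I_N, (1 <= n k)%N) /\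
      (forall k l : 'I_N, (k < l)%N -> (n k < n l)%N) /\
      (forall k : 'I_N, 0 < c k) /\
      (\sum_(j < N) c j ^+ 2) *
        expR (gamma * Num.sqrt (ln N%:R * ln (ln (ln N%:R)) / ln (ln N%:R)))
      <= \sum_(k < N) \sum_(l < N)
           c k * c l * ((gcdn (n k) (n l))%:R / Num.sqrt (n k * n l)%:R).
Proof.
(* With [d = (1 - gamma) / 5], [(1 - d) ^ 4] exceeds [1 - 5 d = gamma]. *)
pose g := 1 - (1 - gamma) / 5.
have g01 : 0 < g < 1 by rewrite /g; apply/andP; split; lra.
have g4 : gamma < g ^+ 4.
  have -> : g ^+ 4 = gamma + (1 - gamma) / 5 *
    (1 + (1 - gamma) / 5 * (6 - 4 * ((1 - gamma) / 5) + ((1 - gamma) / 5) ^+ 2)).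
    by rewrite /g; field.
  set d := (1 - gamma) / 5; have d0 : 0 < d by rewrite divr_gt0 // subr_gt0.
  have d1 : d < 1 by rewrite /d; lra.
  rewrite ltrDl mulr_gt0 // addr_gt0 // mulr_gt0 // addr_gt0 ?exprn_gt0 //; lra.
have [lam0 H] := @chunks_exist R g g01.
(* The maximum with 1 makes the triple logarithm of [N] positive, so no logarithm takes its default
   value and the square root is positive. *)
exists (Num.truncn (expR (expR (expR (Num.max 1 lam0))))).+1 => N HN.
have N1 : expR (expR (expR (Num.max 1 lam0))) < N%:R.
  by apply: lt_le_trans (truncnS_gt _) _; rewrite ler_nat.
have N0 : 0 < N%:R :> R by apply: lt_trans N1; apply: expR_gt0.
have L1 : expR (expR (Num.max 1 lam0)) < ln N%:R by rewrite -ltr_expR lnK.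
have L0 : 0 < ln N%:R :> R by apply: lt_trans L1; apply: expR_gt0.
have l1 : expR (Num.max 1 lam0) < ln (ln N%:R) by rewrite -ltr_expR lnK.
have l0 : 0 < ln (ln N%:R) :> R by apply: lt_trans l1; apply: expR_gt0.
have : Num.max 1 lam0 < ln (ln (ln N%:R)) by rewrite -ltr_expR lnK.
rewrite gt_max; set lam := ln (ln (ln N%:R)) => /andP[lam1 /ltW /H].
rewrite /lam !lnK // -/lam => -[Qs [q1 q2 q3 q4 q5]].
have [s [us sp _ sz [s0 sf]]] := @chunk_system R Qs q1 q2 q3.
have sN : (size s <= N)%N by rewrite sz -(ler_nat R).
set rho := expR (gamma * _).
(* The strict gap between [gamma] and [g ^ 4] provides the slack for completing the system. *)
have rs : sq_weight s * rho < gcd_form s s.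
  apply: lt_le_trans sf; rewrite ltr_pM2l //; apply: lt_le_trans q5.
  rewrite ltr_expR ltr_pM2r // sqrtr_gt0 divr_gt0 // mulr_gt0 //.
  exact: lt_trans lam1.
have [t [ut tp tN tf]] := @gcd_system_fill R N s rho us sp sN (expR_gt0 _) rs.
exact: (@gcd_system_realize R N t rho ut tp tN tf).
Qed.
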